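(* Let $\mathbb{F}=\mathbb{R}$ or $\mathbb{C}$, let $A\in\mathbb{F}^{n\times n}$ be Hermitian and invertible, let $\mathcal{S}$ be a $p$-dimensional linear subspace of $\mathbb{F}^n$ with $1\le p\le n$, let $b\in\mathbb{F}^n$, and let $\omega_{\min}:=-\lambda_{\min}(A)$. Let $\mathbf{D}_A(\cdot)b:(\omega_{\min},\infty)\to\mathbb{F}^n$ be the map $\omega\mapsto x_{b,\omega}:=\operatorname*{arg\,min}_{x\in\mathcal{S}}\|(A+\omega I)^{-1/2}(b-Ax)\|_2$. Suppose that $\mathbf{D}_A(\cdot)b$ is not a constant map. Then the set of points in $(\omega_{\min},\infty)$ where $\mathbf{D}_A(\cdot)b$ is not locally injective has ($1$-dimensional) Lebesgue measure zero, and is a discrete, countable set.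
   Context: $\lambda_{\min}(A)$ is the smallest eigenvalue of $A$. For $\omega>\omega_{\min}$, $A+\omega I$ is Hermitian positive definite, its power $-1/2$ is defined via the spectral decomposition, and the minimizer exists and is unique; explicitly $x_{b,\omega}=\mathbf{D}_A(\omega)b$ with $\mathbf{D}_A(\omega)=V(V^*A(A+\omega I)^{-1}AV)^{-1}V^*A(A+\omega I)^{-1}$ for any $V\in\mathbb{F}^{n\times p}$ with orthonormal columns spanning $\mathcal{S}$. The map is locally injective at $\omega$ if there is an open interval $(\omega_1,\omega_2)\subseteq(\omega_{\min},\infty)$ containing $\omega$ on which its restriction is injective. A set $\mathcal{Z}\subseteq\mathbb{R}$ is discrete if each $z\in\mathcal{Z}$ is contained in an open interval containing no other point of $\mathcal{Z}$. ''Countable'' includes finite or empty. *)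

(* Defs.v *)
From HB Require Import structures.
From mathcomp Require Import all_boot all_order all_algebra.
From mathcomp Require Import all_classical all_reals all_analysis.
From mathcomp Require Import complex.

Set Implicit Arguments.
Unset Strict Implicit.
Unset Printing Implicit Defensive.

Import Order.TTheory GRing.Theory Num.Theory.

Local Open Scope classical_set_scope.
Local Open Scope ring_scope.

Inductive scalars := RealScalars | ComplexScalars.

Section Scalars.
Variables (R : realType).

Definition scalar_field (k : scalars) : numFieldType :=
  match k with RealScalars => R | ComplexScalars => R[i] end.

Definition of_real (k : scalars) : R -> scalar_field k :=
  match k with
  | RealScalars => fun x : R => x
  | ComplexScalars => fun x : R => x%:C%C
  end.

Definition re_part (k : scalars) : scalar_field k -> R :=
  match k with
  | RealScalars => fun x : R => x
  | ComplexScalars => fun x : R[i] => complex.Re x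
  end.

Definition conj_scalar (k : scalars) : scalar_field k -> scalar_field k :=
  match k with
  | RealScalars => fun x : R => x
  | ComplexScalars => fun x : R[i] => x^*%C
  end.

End Scalars.

Section Matrices.
Variables (R : realType) (k : scalars).
Local Notation F := (scalar_field R k).

Definition adjoint m n (A : 'M[F]_(m, n)) : 'M[F]_(n, m) :=
  (map_mx (@conj_scalar R k) A)^T.

Definition is_hermitian n (A : 'M[F]_n) := adjoint A = A.

(* The library norm of an entry is a (nonnegative real) element of F, whence
   re_part. *)
Definition norm2 n (x : 'cV[F]_n) : R :=
  Num.sqrt (\sum_(i < n) (re_part `|x i ord0|) ^+ 2).

(* For F = R[i], [l <= m] in F means that m - l is a nonnegative real. *)
Definition is_smallest_eigenvalue n (A : 'M[F]_n) (l : R) :=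
  eigenvalue A (of_real k l) /\
  forall m : F, eigenvalue A m -> of_real k l <= m.

Definition lambda_min n (A : 'M[F]_n) : R :=
  xget 0 [set l | is_smallest_eigenvalue A l].

(* Power with a real exponent via the spectral decomposition; the result does
   not depend on the decomposition chosen.  Junk value 0 if M is not Hermitian;
   only meaningful for positive definite M. *)
Definition is_spectral_pow n (M : 'M[F]_n) (s : R) (B : 'M[F]_n) :=
  exists (U : 'M[F]_n) (d : 'I_n -> R),
    [/\ adjoint U *m U = 1%:M,
        M = U *m diag_mx (\row_i of_real k (d i)) *m adjoint U
      & B = U *m diag_mx (\row_i of_real k (d i `^ s)) *m adjoint U].

Definition spectral_pow n (M : 'M[F]_n) (s : R) : 'M[F]_n :=
  xget 0 [set B | is_spectral_pow M s B].

Definition is_argmin n (S : {vspace 'cV[F]_n}) (f : 'cV[F]_n -> R)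
    (x : 'cV[F]_n) :=
  x \in S /\ forall y, y \in S -> f x <= f y.

Definition argmin n (S : {vspace 'cV[F]_n}) (f : 'cV[F]_n -> R) : 'cV[F]_n :=
  xget 0 [set x | is_argmin S f x].

Definition omega_min n (A : 'M[F]_n) : R := - lambda_min A.

Definition D_A n (A : 'M[F]_n) (S : {vspace 'cV[F]_n}) (b : 'cV[F]_n)
    (w : R) : 'cV[F]_n :=
  argmin S (fun x =>
    norm2 (spectral_pow (A + (of_real k w)%:M) (- 2^-1) *m (b - A *m x))).

End Matrices.

Section RealLine.
Variable R : realType.

(* Notions for a map with domain ]a, +oo[; its values outside that domain are
   ignored. *)
Definition constant_on_ray (T : Type) (a : R) (f : R -> T) :=
  exists c : T, forall w, a < w -> f w = c.

Definition locally_injective_at (T : Type) (a : R) (f : R -> T) (w : R) :=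
  exists w1 w2 : R,
    [/\ `]w1, w2[ `<=` `]a, +oo[, w1 < w < w2
      & forall u v, w1 < u < w2 -> w1 < v < w2 -> f u = f v -> u = v].

Definition discrete_subset (Z : set R) :=
  forall z, Z z -> exists z1 z2 : R,
    z1 < z < z2 /\ forall y, Z y -> z1 < y < z2 -> y = z.

End RealLine.

(* Main.v *)
From HB Require Import structures.
Require Import Defs.
From mathcomp Require Import all_boot all_order all_algebra.
From mathcomp Require Import all_classical all_reals all_analysis.
From mathcomp Require Import complex polyrcf ring lra.

(* On the ray, the normal equations give the minimizer as an explicit matrix
   expression in w, so the real and imaginary parts of its entries are real
   rational functions of w without pole. If the map is not constant, one of
   these functions, P / Q, is not constant, so N = P' Q - P Q' is a nonzero
   polynomial. By the mean value theorem P / Q is injective near each point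
   where N does not vanish, so the exceptional points are among the finitely
   many roots of N. *)

Set Implicit Arguments.
Unset Strict Implicit.
Unset Printing Implicit Defensive.

Import Order.TTheory GRing.Theory Num.Theory.
Import numFieldNormedType.Exports.

Local Open Scope classical_set_scope.
Local Open Scope ring_scope.

(** * Real and complex scalars treated uniformly: conjugation, embedding of the reals, real and
    imaginary parts *)

Section ScalarTheory.
Variables (R : realType) (k : scalars).
Local Notation F := (scalar_field R k).
Local Notation conj := (@conj_scalar R k).
Local Notation ofR := (@of_real R k).
Local Notation re := (@re_part R k).

Fact conj_scalar_is_zmod_morphism : zmod_morphism conj.
Proof. by case: k => //= x y; rewrite rmorphB. Qed.

Fact conj_scalar_is_monoid_morphism : monoid_morphism conj.
Proof. by case: k => //=; split=> [|x y]; rewrite ?rmorph1 ?rmorphM. Qed.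

HB.instance Definition _ := GRing.isZmodMorphism.Build F F conj
  conj_scalar_is_zmod_morphism.
HB.instance Definition _ := GRing.isMonoidMorphism.Build F F conj
  conj_scalar_is_monoid_morphism.

Fact of_real_is_zmod_morphism : zmod_morphism ofR.
Proof. by case: k => //= x y; rewrite rmorphB. Qed.

Fact of_real_is_monoid_morphism : monoid_morphism ofR.
Proof. by case: k => //=; split=> [|x y]; rewrite ?rmorph1 ?rmorphM. Qed.

HB.instance Definition _ := GRing.isZmodMorphism.Build R F ofR
  of_real_is_zmod_morphism.
HB.instance Definition _ := GRing.isMonoidMorphism.Build R F ofR
  of_real_is_monoid_morphism.

Lemma conj_scalarK : involutive conj.
Proof. by case: k => //= x; rewrite conjcK. Qed.

Lemma conj_of_real x : conj (ofR x) = ofR x.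
Proof. by case: k => //=; exact: conjc_real. Qed.

Lemma of_realK : cancel ofR re.
Proof. by case: k. Qed.

Lemma ler_of_real x y : (ofR x <= ofR y) = (x <= y).
Proof. by case: k => //=; exact: lecR. Qed.

(** Links the library norm inside [norm2] to products with the adjoint. *)
Lemma conj_scalar_normSq x : conj x * x = ofR ((re `|x|) ^+ 2).
Proof.
case: k x => /= x; first by rewrite real_normK ?num_real // expr2.
by case: x => a b; rewrite mulrC -sqr_normc normc_def -rmorphXn.
Qed.

Definition im_part (x : F) : R :=
  match k return scalar_field R k -> R with
  | RealScalars => fun=> 0
  | ComplexScalars => fun x : R[i] => complex.Im x
  end x.
Local Notation im := im_part.

Lemma re_partD x y : re (x + y) = re x + re y.
Proof. by case: k x y => //= -[a b] [c d]. Qed.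

Lemma im_partD x y : im (x + y) = im x + im y.
Proof. by rewrite /im_part; case: k x y => [x y|[a b] [c d]]; rewrite /= ?addr0. Qed.

Lemma re_partM x y : re (x * y) = re x * re y - im x * im y.
Proof.
by rewrite /im_part; case: k x y => [x y|[a b] [c d]]; rewrite /= ?mulr0 ?subr0.
Qed.

Lemma im_partM x y : im (x * y) = re x * im y + im x * re y.
Proof.
by rewrite /im_part; case: k x y => [x y|[a b] [c d]]; rewrite /= ?mulr0 ?mul0r ?addr0.
Qed.

Lemma re_partV x : re x^-1 = re x / (re x ^+ 2 + im x ^+ 2).
Proof.
rewrite /im_part; case: k x => [x|[a b]] //=; rewrite expr0n addr0 /= expr2.
have [->|x0] := eqVneq x 0; first by rewrite invr0 mul0r.
by rewrite invfM mulrA divff // mul1r.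
Qed.

Lemma im_partV x : im x^-1 = - im x / (re x ^+ 2 + im x ^+ 2).
Proof.
rewrite /im_part; case: k x => [x|[a b]] //=; first by rewrite oppr0 mul0r.
by rewrite mulNr.
Qed.

Lemma eq_scalar x y : re x = re y -> im x = im y -> x = y.
Proof. by rewrite /im_part; case: k x y => //= -[a b] [c d] /= -> ->. Qed.

Lemma re_im_sqr_eq0 x : re x ^+ 2 + im x ^+ 2 = 0 -> x = 0.
Proof.
move/eqP; rewrite paddr_eq0 ?sqr_ge0 // !sqrf_eq0 => /andP[/eqP r0 /eqP i0].
by apply: eq_scalar; rewrite ?r0 ?i0 /im_part; case: k.
Qed.

Lemma im_of_real x : im (ofR x) = 0.
Proof. by rewrite /im_part; case: k. Qed.

End ScalarTheory.

(** * Adjoint matrices and the Euclidean norm *)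

Section Adjoint.
Variables (R : realType) (k : scalars).
Local Notation F := (scalar_field R k).
Local Notation ofR := (@of_real R k).

Lemma adjointE m n (A : 'M[F]_(m, n)) i j : adjoint A i j = conj_scalar (A j i).
Proof. by rewrite !mxE. Qed.

Lemma adjointK m n : cancel (@adjoint R k m n) (@adjoint R k n m).
Proof. by move=> A; apply/matrixP => i j; rewrite !adjointE conj_scalarK. Qed.

Lemma adjointM m n p (A : 'M[F]_(m, n)) (B : 'M[F]_(n, p)) :
  adjoint (A *m B) = adjoint B *m adjoint A.
Proof. by rewrite /adjoint map_mxM trmx_mul. Qed.

Lemma adjointD m n (A B : 'M[F]_(m, n)) : adjoint (A + B) = adjoint A + adjoint B.
Proof. by rewrite /adjoint map_mxD linearD. Qed.

Lemma adjointZ m n a (A : 'M[F]_(m, n)) :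
  adjoint (a *: A) = conj_scalar a *: adjoint A.
Proof. by rewrite /adjoint map_mxZ linearZ. Qed.

Lemma adjoint_scalar n (x : R) : adjoint (ofR x)%:M = (ofR x)%:M :> 'M[F]_n.
Proof. by rewrite /adjoint map_scalar_mx /= conj_of_real tr_scalar_mx. Qed.

Lemma adjoint0 m n : adjoint 0 = 0 :> 'M[F]_(m, n).
Proof. by rewrite /adjoint map_mx0 trmx0. Qed.

Lemma adjoint_real_diag n (d : 'I_n -> R) :
  adjoint (diag_mx (\row_i ofR (d i))) = diag_mx (\row_i ofR (d i)).
Proof.
apply/matrixP => i j; rewrite adjointE !mxE rmorphMn /= conj_of_real.
by have [->|ij] := eqVneq i j; rewrite ?eqxx // eq_sym (negPf ij).
Qed.

Lemma adjoint_row_mx m n p (A : 'M[F]_(m, n)) (B : 'M[F]_(m, p)) :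
  adjoint (row_mx A B) = col_mx (adjoint A) (adjoint B).
Proof. by rewrite /adjoint map_row_mx tr_row_mx. Qed.

Lemma norm2_ge0 n (x : 'cV[F]_n) : 0 <= norm2 x.
Proof. exact: sqrtr_ge0. Qed.

Lemma adjoint_mul_norm2 n (x : 'cV[F]_n) :
  adjoint x *m x = (ofR (norm2 x ^+ 2))%:M.
Proof.
rewrite [LHS]mx11_scalar sqr_sqrtr ?sumr_ge0 // => [|i _]; last exact: sqr_ge0.
congr (_%:M); rewrite mxE rmorph_sum; apply: eq_bigr => i _.
by rewrite adjointE conj_scalar_normSq.
Qed.

Lemma norm2_sqr n (x : 'cV[F]_n) :
  norm2 x ^+ 2 = re_part ((adjoint x *m x) ord0 ord0).
Proof. by rewrite adjoint_mul_norm2 mxE eqxx of_realK. Qed.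

Lemma norm2_eq0 n (x : 'cV[F]_n) : norm2 x = 0 -> x = 0.
Proof.
move=> x0; apply/matrixP => i j; rewrite ord1 [RHS]mxE.
have /eqP : \sum_(i < n) (re_part `|x i ord0|) ^+ 2 = 0.
  rewrite -[LHS]sqr_sqrtr ?sumr_ge0 // => [|j' _]; last exact: sqr_ge0.
  by rewrite -/(norm2 x) x0 expr0n.
rewrite psumr_eq0 => [/allP/(_ i)|? _]; last exact: sqr_ge0.
rewrite mem_index_enum => /(_ isT)/eqP xi0.
have := conj_scalar_normSq (x i ord0); rewrite xi0 rmorph0 => /eqP.
rewrite mulf_eq0 => /orP[/eqP c0|/eqP //].
by rewrite -[LHS]conj_scalarK c0 rmorph0.
Qed.

Lemma adjoint_mul_eq0 n (x : 'cV[F]_n) : adjoint x *m x = 0 -> x = 0.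
Proof.
move=> xx; apply: norm2_eq0; apply/eqP; rewrite -sqrf_eq0 norm2_sqr xx mxE.
by rewrite -(rmorph0 ofR) of_realK.
Qed.

End Adjoint.

(** * The spectral theorem for Hermitian matrices over both fields *)

Section Spectral.
Variable R : realType.

(** Library eigenvectors are rows [v]. The column [adjoint v] is a right eigenvector for the
    conjugate of [a], and evaluating [v *m A *m adjoint v] in two ways compares the two
    eigenvalues. *)
Lemma hermitian_eigenvalue_conj k n (A : 'M[scalar_field R k]_n) a :
  is_hermitian A -> eigenvalue A a -> conj_scalar a = a.
Proof.
move=> hA /eigenvalueP[v vA v0]; set w := adjoint v.
have w0 : w != 0.
  by apply: contra v0 => /eqP w0; rewrite -[v]adjointK -/w w0 adjoint0.
have Aw : A *m w = conj_scalar a *: w by rewrite -{1}hA -adjointM vA adjointZ.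
have : v *m A *m w = v *m (A *m w) by rewrite mulmxA.
rewrite vA Aw -scalemxAl -scalemxAr => /eqP; rewrite -subr_eq0 -scalerBl.
rewrite scaler_eq0 subr_eq0 => /orP[/eqP //|/eqP vw0].
by case/eqP: w0; apply: adjoint_mul_eq0; rewrite /w adjointK.
Qed.

(** Over the complex numbers the polynomial splits, and its roots are eigenvalues, hence real. A
    real symmetric matrix is Hermitian over the complex numbers, and the factorization descends
    since the embedding of polynomials is injective. *)
Lemma hermitian_char_poly k n (A : 'M[scalar_field R k]_n) : is_hermitian A ->
  exists s : seq R, char_poly A = \prod_(l <- s) ('X - (of_real k l)%:P).
Proof.
have complex_case (B : 'M[scalar_field R ComplexScalars]_n) : is_hermitian B ->
  exists s : seq R,
    char_poly B = \prod_(l <- s) ('X - (of_real ComplexScalars l)%:P).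
  move=> hB; have [r] := @closed_field_poly_normal R[i] (char_poly B).
  rewrite (monicP (char_poly_monic B)) scale1r => charB.
  exists (map (@complex.Re R) r); rewrite big_map charB big_seq [RHS]big_seq.
  apply: eq_bigr => z zr; congr ('X - _%:P).
  have : conj_scalar (k := ComplexScalars) z = z.
    apply: hermitian_eigenvalue_conj hB _; rewrite eigenvalue_root_char.
    by rewrite [char_poly B]charB root_prod_XsubC.
  case: z zr => x y _ /= [] /eqP.
  by rewrite eq_sym -addr_eq0 -mulr2n mulrn_eq0 /= => /eqP ->.
case: k A => A hA; last exact: complex_case.
have [|s] := complex_case (map_mx (real_complex R) A).
  apply/matrixP => i j; have /matrixP/(_ i j) := hA; rewrite adjointE !mxE => <-.
  exact: conjc_real.
rewrite -[char_poly _](map_char_poly (real_complex R) A) => charA.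
exists s; apply: (map_poly_inj (real_complex R)).
rewrite [LHS]charA rmorph_prod; apply: eq_bigr => l _ /=.
by rewrite rmorphB /= map_polyX map_polyC.
Qed.

Section Diagonalization.
Variables (k : scalars).
Local Notation F := (scalar_field R k).
Local Notation ofR := (@of_real R k).

(* By Cayley-Hamilton the product of the A - l kills w; v is the last nonzero
   partial product applied to w. *)
Lemma eigenvector_in_stable_subspace n (A : 'M[F]_n) (P : 'cV[F]_n -> Prop) w :
  is_hermitian A -> (forall x l, P x -> P (A *m x - l *: x)) -> P w -> w != 0 ->
  exists (l : R) (v : 'cV[F]_n), [/\ P v, v != 0 & A *m v = ofR l *: v].
Proof.
case: n A P w => [|n] A P w hA Pst Pw w0.
  by case/eqP: w0; apply/matrixP => -[].
have [s charA] := hermitian_char_poly hA.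
have := Cayley_Hamilton A; rewrite charA.
have : P (horner_mx A (\prod_(l <- s) ('X - (ofR l)%:P)) *m w) /\
    (horner_mx A (\prod_(l <- s) ('X - (ofR l)%:P)) *m w = 0 ->
     exists (l : R) (v : 'cV[F]_n.+1), [/\ P v, v != 0 & A *m v = ofR l *: v]).
  elim: s {charA} => [|l s [Ps IHs]].
    rewrite big_nil rmorph1 mul1mx; split=> // w0'.
    by case/eqP: w0.
  rewrite big_cons rmorphM rmorphB /= horner_mx_X horner_mx_C.
  rewrite -mulmxE -mulmxA mulmxBl mul_scalar_mx; split; first exact: Pst.
  set x := _ *m w in Ps IHs *; move/eqP; rewrite subr_eq0 => /eqP Ax.
  have [/IHs //|x0] := eqVneq x 0.
  by exists l, x.
by case=> _ + h; apply; rewrite h mul0mx.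
Qed.

(** A dimension count; [kermx] is a left kernel, whence the transposes. *)
Lemma adjoint_kernel_neq0 n m (U : 'M[F]_(n, m)) : (m < n)%N ->
  exists2 w : 'cV[F]_n, w != 0 & adjoint U *m w = 0.
Proof.
move=> mn; have : kermx (adjoint U)^T != 0.
  rewrite -mxrank_eq0 mxrank_ker -lt0n subn_gt0.
  exact: leq_ltn_trans (rank_leq_col _) mn.
case/rowV0Pn => v /sub_kermxP vU v0; exists v^T.
  by apply: contra v0 => /eqP v0; rewrite -[v]trmxK v0 trmx0.
by apply: trmx_inj; rewrite trmx_mul trmxK vU trmx0.
Qed.

(** Induction on [m]: the orthogonal complement of the eigenvectors found so far is stable under
    [A], so it contains a further eigenvector, which is normalized and prepended. *)
Lemma orthonormal_eigenvectors n (A : 'M[F]_n) m : is_hermitian A -> (m <= n)%N ->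
  exists (U : 'M[F]_(n, m)) (d : 'rV[R]_m),
    adjoint U *m U = 1%:M /\ A *m U = U *m diag_mx (map_mx ofR d).
Proof.
move=> hA; elim: m => [|m IHm] mn.
  by exists 0, 0; split; apply/matrixP => i []; case: i.
have [U [d [UU AU]]] := IHm (ltnW mn).
have [w w0 Uw] := adjoint_kernel_neq0 U mn.
have [|//|//|l [v [Uv v0 Av]]] :=
    @eigenvector_in_stable_subspace n A (fun x => adjoint U *m x = 0) w hA _ _ _.
  (* Stability: [adjoint U *m A] is the adjoint of [A *m U], that is, a diagonal matrix times
     [adjoint U], and so kills [x]. *)
  move=> x l Ux; rewrite mulmxBr -scalemxAr Ux scaler0 subr0 mulmxA.
  rewrite -{1}hA -adjointM AU adjointM -mulmxA Ux mulmx0 //.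
pose a := ofR (norm2 v)^-1; pose u := a *: v.
have nv0 : norm2 v != 0 by apply: contra v0 => /eqP/norm2_eq0/eqP.
have uu : adjoint u *m u = 1%:M.
  rewrite /u adjointZ -scalemxAl -scalemxAr adjoint_mul_norm2 scalerA.
  rewrite scale_scalar_mx conj_of_real -!rmorphM /= -expr2 -exprMn.
  by rewrite mulVf // expr1n rmorph1.
have Uu : adjoint U *m u = 0 by rewrite -scalemxAr Uv scaler0.
have UU' : adjoint (row_mx u U) *m row_mx u U = 1%:M.
  rewrite adjoint_row_mx mul_col_row uu UU Uu.
  rewrite (_ : adjoint u *m U = 0); first by rewrite -scalar_mx_block.
  by rewrite -[LHS]adjointK adjointM adjointK Uu adjoint0.
have AU' : A *m row_mx u U =
    row_mx u U *m diag_mx (map_mx ofR (row_mx (l%:M : 'rV_1) d)).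
  rewrite map_row_mx diag_mx_row mul_mx_row mul_row_block !mulmx0 addr0 add0r AU.
  congr row_mx; rewrite -scalemxAr Av scalerA mulrC -scalerA -/u.
  rewrite (_ : diag_mx _ = (ofR l)%:M) ?mul_mx_scalar //.
  by apply/matrixP => i j; rewrite !ord1 !mxE.
by exists (row_mx u U), (row_mx l%:M d); split; [exact: UU'|exact: AU'].
Qed.

Theorem hermitian_spectral n (A : 'M[F]_n) : is_hermitian A ->
  exists (U : 'M[F]_n) (d : 'I_n -> R),
    adjoint U *m U = 1%:M /\ A = U *m diag_mx (\row_i ofR (d i)) *m adjoint U.
Proof.
move=> hA; have [U [d [UU AU]]] := orthonormal_eigenvectors hA (leqnn n).
exists U, (d ord0); split=> //.
rewrite (_ : \row__ _ = map_mx ofR d); last by apply/rowP => i; rewrite !mxE.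
by rewrite -AU -mulmxA (mulmx1C UU) mulmx1.
Qed.

Lemma spectral_eigenvalue n (A U : 'M[F]_n) (d : 'I_n -> R) i :
  adjoint U *m U = 1%:M -> A = U *m diag_mx (\row_i ofR (d i)) *m adjoint U ->
  eigenvalue A (ofR (d i)).
Proof.
move=> UU AE; apply/eigenvalueP; exists (row i (adjoint U)).
  by rewrite AE -row_mul !mulmxA UU mul1mx row_mul row_diag_mx -scalemxAl -rowE mxE.
have : row i (adjoint U *m U) != 0.
  apply/eqP => /matrixP/(_ ord0 i)/eqP; rewrite UU !mxE eqxx oner_eq0 //.
by apply: contra => /eqP Ui0; rewrite row_mul Ui0 mul0mx.
Qed.

End Diagonalization.
End Spectral.

(** * The shifted matrix, its power -1/2, and the explicit minimizer *)

Section Shifted.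
Variables (R : realType) (k : scalars).
Local Notation F := (scalar_field R k).
Local Notation ofR := (@of_real R k).

(** The characteristic polynomial has degree [n > 0] and only real roots, so its list of roots has a
    least element; hence [lambda_min] is not the default value of [xget]. *)
Lemma lambda_min_eigenvalue n (A : 'M[F]_n) :
  is_hermitian A -> (0 < n)%N -> is_smallest_eigenvalue A (lambda_min A).
Proof.
move=> hA n_gt0; have [s charA] := hermitian_char_poly hA.
apply: (@xgetPex _ 0 [set l | is_smallest_eigenvalue A l]).
have spec a : eigenvalue A a -> exists2 l, l \in s & a = ofR l.
  rewrite eigenvalue_root_char charA -(big_map ofR xpredT (fun z => 'X - z%:P)).
  by rewrite root_prod_XsubC => /mapP.
have size_s : (0 < size s)%N.
  have := size_char_poly A; rewrite charA size_prod_XsubC => -[->].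
  by [].
case: (@arg_minP _ R _ (Ordinal size_s) xpredT (fun i => s`_i)) => // i _ min_i.
exists s`_i; split.
  rewrite eigenvalue_root_char charA -(big_map ofR xpredT (fun z => 'X - z%:P)).
  by rewrite root_prod_XsubC map_f // mem_nth.
move=> a /spec[l ls ->]; rewrite ler_of_real.
rewrite -(nth_index 0 ls); move: ls; rewrite -index_mem => ls.
exact: (min_i (Ordinal ls)).
Qed.

Lemma eigenvalue_shift_gt0 n (A : 'M[F]_n) (w e : R) :
  is_hermitian A -> (0 < n)%N -> omega_min A < w ->
  eigenvalue (A + (ofR w)%:M) (ofR e) -> 0 < e.
Proof.
move=> hA n_gt0 ww /eigenvalueP[v vA v0].
(* An eigenvector of the shifted matrix for [e] is one of [A] for [e - w]. *)
have : lambda_min A <= e - w.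
  rewrite -(ler_of_real k); have [_] := lambda_min_eigenvalue hA n_gt0; apply.
  apply/eigenvalueP; exists v => //; rewrite rmorphB scalerBl -vA mulmxDr.
  by rewrite mul_mx_scalar addrK.
by move: ww; rewrite /omega_min; lra.
Qed.

Lemma shift_hermitian n (A : 'M[F]_n) w :
  is_hermitian A -> is_hermitian (A + (ofR w)%:M).
Proof. by rewrite /is_hermitian adjointD adjoint_scalar => ->. Qed.

(** Captures the power -1/2 by an identity in which no decomposition appears. In whichever
    decomposition [xget] picks, it reduces to scalar identities for the positive eigenvalues
    [d i]. *)
Lemma spectral_pow_sqr n (A : 'M[F]_n) w :
    is_hermitian A -> (0 < n)%N -> omega_min A < w ->
  let M := A + (ofR w)%:M in let B := spectral_pow M (- 2^-1) in
  adjoint B *m B *m M = 1%:M.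
Proof.
move=> hA n_gt0 ww M B; have hM : is_hermitian M := shift_hermitian w hA.
have : is_spectral_pow M (- 2^-1) B.
  apply: (@xgetPex _ 0 [set B | is_spectral_pow M (- 2^-1) B]).
  have [U [d [UU ME]]] := hermitian_spectral hM.
  by exists (U *m diag_mx (\row_i ofR (d i `^ (- 2^-1))) *m adjoint U), U, d.
case=> U [d [UU ME BE]].
have d_gt0 i : 0 < d i.
  exact: eigenvalue_shift_gt0 hA n_gt0 ww (spectral_eigenvalue i UU ME).
have hB : adjoint B = B.
  by rewrite BE !adjointM adjointK adjoint_real_diag mulmxA.
rewrite hB BE ME !mulmxA -(mulmxA _ (adjoint U) U) UU mulmx1.
rewrite -(mulmxA _ (adjoint U) U) UU mulmx1.
rewrite -(mulmxA U) mulmx_diag -(mulmxA U) mulmx_diag.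
rewrite (_ : diag_mx _ = 1%:M) ?mulmx1 ?(mulmx1C UU) //.
rewrite -diag_const_mx; congr diag_mx; apply/rowP => i; rewrite !mxE.
rewrite -!rmorphM /= -(rmorph1 ofR); congr (ofR _).
have d0 := lt0r_neq0 (d_gt0 i).
rewrite -powRD ?d0 ?implybT // (_ : - 2^-1 - 2^-1 = -1); last by lra.
by rewrite powR_inv1 ?ltW // mulVf.
Qed.

Lemma shift_unitmx n (A : 'M[F]_n) w :
  is_hermitian A -> (0 < n)%N -> omega_min A < w -> A + (ofR w)%:M \in unitmx.
Proof. by move=> hA n_gt0 ww; have /mulmx1_unit[] := spectral_pow_sqr hA n_gt0 ww. Qed.

(** The residual at [x] is orthogonal to the image of [S] under [K], so Pythagoras makes [x] a
    minimizer; injectivity of [K] makes it the only one, which determines the value of [xget]. *)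
Lemma argmin_least_squares n m (S : {vspace 'cV[F]_n}) (K : 'M[F]_(m, n))
    (c : 'cV[F]_m) x (f : 'cV[F]_n -> R) :
    (forall y, f y = norm2 (c - K *m y)) -> (forall y : 'cV_n, K *m y = 0 -> y = 0) ->
    x \in S -> (forall y : 'cV_n, y \in S -> adjoint (K *m y) *m (c - K *m x) = 0) ->
  argmin S f = x.
Proof.
move=> fE Kinj xS orth.
have pythagoras y : y \in S -> f y ^+ 2 = f x ^+ 2 + norm2 (K *m (x - y)) ^+ 2.
  move=> yS; have xyS : x - y \in S by rewrite rpredB.
  have E : c - K *m y = (c - K *m x) + K *m (x - y).
    by rewrite mulmxBr addrA subrK.
  have o := orth _ xyS; have o' : adjoint (c - K *m x) *m (K *m (x - y)) = 0.
    by rewrite -[LHS]adjointK adjointM adjointK o adjoint0.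
  rewrite !fE !norm2_sqr E; set u := c - _ in o o' *; set v := K *m _ in o o' *.
  move: u v o o' {E} => u v o o'.
  by rewrite adjointD mulmxDl !mulmxDr o o' addr0 add0r mxE re_partD.
apply: xget_unique => [|y [yS ymin]].
  split=> // y yS; rewrite -(@ler_pXn2r _ 2) ?nnegrE ?fE ?norm2_ge0 // -!fE.
  by rewrite (pythagoras y) // lerDl sqr_ge0.
(* For another minimizer [y], Pythagoras forces [K *m (x - y)] to have norm zero. *)
have := ymin _ xS; rewrite -(@ler_pXn2r _ 2) ?nnegrE ?fE ?norm2_ge0 // -!fE.
rewrite (pythagoras y) // gerDl => n0; apply/eqP; rewrite eq_sym -subr_eq0; apply/eqP.
by apply/Kinj/norm2_eq0/eqP; rewrite -sqrf_eq0 eq_le n0 sqr_ge0.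
Qed.

(** The columns of [V] form a basis of [S], not necessarily orthonormal. *)
Lemma vspace_basis_mx n (S : {vspace 'cV[F]_n}) :
  exists V : 'M[F]_(n, \dim S),
    (forall z : 'cV_(\dim S), V *m z = 0 -> z = 0) /\
    (forall y, y \in S <-> exists z : 'cV_(\dim S), y = V *m z).
Proof.
pose V := \matrix_(i, j) (vbasis S)`_j i ord0 : 'M[F]_(n, \dim S).
have VE z : V *m z = \sum_j z j ord0 *: (vbasis S)`_j.
  apply/matrixP => i j; rewrite ord1 mxE summxE; apply: eq_bigr => l _.
  by rewrite !mxE mulrC.
exists V; split=> [z|y].
  have /freeP free_basis := basis_free (vbasisP S).
  rewrite VE => /(free_basis (fun j => z j ord0)) z0.
  by apply/matrixP => i j; rewrite ord1 z0 mxE.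
split=> [yS|[z ->]]; last first.
  by rewrite VE rpred_sum // => i _; rewrite rpredZ // vbasis_mem // mem_nth // size_tuple.
exists (\col_j coord (vbasis S) j y); rewrite VE {1}(coord_vbasis yS).
by apply: eq_bigr => j _; rewrite mxE.
Qed.

(** The matrix of the normal equations in the coordinates given by [V]; it is the factor inverted in
    the explicit formula for the minimizer. *)
Definition normal_gram n p (A : 'M[F]_n) (V : 'M[F]_(n, p)) (w : R) : 'M[F]_p :=
  adjoint V *m A *m invmx (A + (ofR w)%:M) *m A *m V.

Section Formula.
Variables (n p : nat) (A : 'M[F]_n) (V : 'M[F]_(n, p)) (w : R).
Hypotheses (hA : is_hermitian A) (A_unit : A \in unitmx) (n_gt0 : (0 < n)%N).
Hypotheses (Vinj : forall z : 'cV_p, V *m z = 0 -> z = 0) (ww : omega_min A < w).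

Let M := A + (ofR w)%:M.
Let B := spectral_pow M (- 2^-1).

Let BB : adjoint B *m B = invmx M.
Proof.
have := spectral_pow_sqr hA n_gt0 ww; rewrite -/M -/B => BBM.
by rewrite -[LHS](mulmxK (shift_unitmx hA n_gt0 ww)) BBM mul1mx.
Qed.

Let BAinj q (y : 'M[F]_(n, q)) : B *m A *m y = 0 -> y = 0.
Proof.
(* [A *m y] equals [M *m adjoint B *m (B *m A *m y)], which vanishes. *)
move=> BAy; rewrite -[y](mulKmx A_unit) -[A *m y]mul1mx.
rewrite -(mulmxV (shift_unitmx hA n_gt0 ww)) -/M -BB -!mulmxA (mulmxA B) BAy.
by rewrite !mulmx0.
Qed.

Lemma normal_gramE : normal_gram A V w = adjoint (B *m A *m V) *m (B *m A *m V).
Proof. by rewrite !adjointM hA /normal_gram -/M -BB !mulmxA. Qed.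

(** It is the Gram matrix of [B *m A *m V], which has trivial kernel. *)
Lemma normal_gram_unit : normal_gram A V w \in unitmx.
Proof.
rewrite -unitmx_tr -row_free_unit -kermx_eq0; apply/rowV0P => v.
move=> /sub_kermxP vG; have : normal_gram A V w *m v^T = 0.
  by apply: trmx_inj; rewrite trmx_mul trmxK vG trmx0.
rewrite normal_gramE => Gv; apply: trmx_inj; rewrite trmx0; apply: Vinj.
apply: BAinj; rewrite mulmxA; apply: adjoint_mul_eq0.
by rewrite adjointM -mulmxA (mulmxA _ _ v^T) Gv mulmx0.
Qed.

Lemma D_A_formula (S : {vspace 'cV[F]_n}) b :
    (forall y, y \in S <-> exists z : 'cV_p, y = V *m z) ->
  D_A A S b w =
    V *m invmx (normal_gram A V w) *m (adjoint V *m A *m invmx M *m b).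
Proof.
(* The weighted problem is an ordinary least squares problem for [B *m A] and [B *m b]; its
   orthogonality condition is the normal equation, in which [adjoint B *m B] becomes [invmx M]. *)
move=> SE; apply: (@argmin_least_squares _ _ _ (B *m A) (B *m b)) => [y|y /BAinj //||].
- by rewrite mulmxBr mulmxA.
- by apply/SE; eexists; rewrite -mulmxA.
move=> _ /SE[z ->]; rewrite mulmxA adjointM -mulmxA mulmxBr.
rewrite -(mulmxA V) (mulmxA (B *m A)) (mulmxA (adjoint (B *m A *m V)) (B *m A *m V)).
rewrite -normal_gramE (mulKVmx normal_gram_unit) !adjointM hA -BB !mulmxA subrr.
by rewrite mulmx0.
Qed.

End Formula.

End Shifted.

(** * Real rational functions without poles on a ray *)

Section RationalOnRay.
Variables (R : realType) (a : R).

Definition rational_on_ray (f : R -> R) := exists P Q : {poly R},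
  forall w, a < w -> Q.[w] != 0 /\ f w = P.[w] / Q.[w].

Lemma rational_on_ray_eq f g : (forall w, a < w -> f w = g w) ->
  rational_on_ray f -> rational_on_ray g.
Proof.
by move=> fg [P [Q PQ]]; exists P, Q => w aw; rewrite -fg //; exact: PQ.
Qed.

Lemma rational_on_ray_poly (P : {poly R}) : rational_on_ray (horner P).
Proof. by exists P, 1 => w _; rewrite hornerC oner_neq0 divr1. Qed.

Lemma rational_on_ray_cst c : rational_on_ray (fun=> c).
Proof.
by apply: rational_on_ray_eq (rational_on_ray_poly c%:P) => w _; rewrite hornerC.
Qed.

Lemma rational_on_rayD f g : rational_on_ray f -> rational_on_ray g ->
  rational_on_ray (fun w => f w + g w).
Proof.
move=> [P [Q PQ]] [P' [Q' PQ']]; exists (P * Q' + P' * Q), (Q * Q') => w aw.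
have [Q0 ->] := PQ w aw; have [Q0' ->] := PQ' w aw.
by rewrite hornerD !hornerM mulf_neq0 // addf_div.
Qed.

Lemma rational_on_rayM f g : rational_on_ray f -> rational_on_ray g ->
  rational_on_ray (fun w => f w * g w).
Proof.
move=> [P [Q PQ]] [P' [Q' PQ']]; exists (P * P'), (Q * Q') => w aw.
have [Q0 ->] := PQ w aw; have [Q0' ->] := PQ' w aw.
by rewrite !hornerM mulf_neq0 // mulf_div.
Qed.

Lemma rational_on_rayN f : rational_on_ray f -> rational_on_ray (fun w => - f w).
Proof.
move=> /(rational_on_rayM (rational_on_ray_cst (-1))).
by apply: rational_on_ray_eq => w _; rewrite mulN1r.
Qed.

Lemma rational_on_rayV f : (forall w, a < w -> f w != 0) -> rational_on_ray f ->
  rational_on_ray (fun w => (f w)^-1).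
Proof.
move=> f0 [P [Q PQ]]; exists Q, P => w aw.
have [Q0 fE] := PQ w aw; rewrite fE invf_div; split=> //.
by apply: contra (f0 w aw) => /eqP P0; rewrite fE P0 mul0r.
Qed.

Lemma rational_on_ray_constant_or_locally_injective f : rational_on_ray f ->
  constant_on_ray a f \/ exists2 N : {poly R}, N != 0 &
    forall w, a < w -> ~~ root N w -> locally_injective_at a f w.
Proof.
move=> [P [Q PQ]]; pose N := P^`() * Q - P * Q^`().
pose g w := P.[w] / Q.[w].
(* Quotient rule: [N] is the numerator of the derivative. *)
have dg w : a < w -> is_derive w 1 g (N.[w] / Q.[w] ^+ 2).
  move=> aw; have [Q0 _] := PQ w aw.
  have dV : is_derive w 1 (fun x => (Q.[x])^-1) _ := is_deriveV Q0 (is_derive_poly Q w).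
  apply: is_derive_eq (is_deriveM (is_derive_poly P w) dV) _.
  rewrite /N !hornerE /GRing.scale /=.
  by field.
have mvt u v : a < u -> u < v ->
    exists2 x, u < x < v & f v - f u = N.[x] / Q.[x] ^+ 2 * (v - u).
  move=> au uv; have [||x] := @MVT R g (fun w => N.[w] / Q.[w] ^+ 2) _ _ uv.
  - by move=> x; rewrite in_itv => /andP[ux _]; apply: dg; exact: lt_trans ux.
  - apply: continuous_in_subspaceT => x; rewrite inE /= in_itv => /andP[ux _].
    have /dg/(@ex_derive _ _ _ _ _ _ _) : a < x by exact: lt_le_trans ux.
    by move=> /derivable1_diffP/differentiable_continuous.
  rewrite in_itv => /= uxv guv; exists x => //.
  by rewrite (PQ u au).2 (PQ v (lt_trans au uv)).2.
have [N0|N0] := eqVneq N 0.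
  (* The derivative vanishes on the ray; [a + 1] is just a reference point there. *)
  left; exists (f (a + 1)).
  have fuv u v : a < u -> u < v -> f v = f u.
    move=> au /(mvt _ _ au)[x _]; rewrite N0 horner0 !mul0r => /eqP.
    by rewrite subr_eq0 => /eqP.
  have a1 : a < a + 1 by rewrite ltrDl.
  by move=> w aw; have [/fuv->|/fuv->|->] := ltgtP w (a + 1).
right; exists N => // w aw Nw.
(* Both conditions are open, so they hold on a ball around [w], which becomes the interval of
   injectivity. *)
have : \forall x \near w, a < x /\ N.[x] != 0.
  near=> x; split; first by near: x; exact: lt_nbhsr.
  near: x; exact: (cvgr_neq0 (horner N w) (@continuous_horner R N w)).
move=> /nbhs_ballP[e /= e_gt0 we].
have we' x : w - e < x < w + e -> a < x /\ N.[x] != 0.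
  by move=> xe; apply: we; rewrite /ball /= ltr_distlC.
have noteq u v : w - e < u -> v < w + e -> u < v -> f u <> f v.
  move=> wu vw uv fuv.
  have [au _] : a < u /\ N.[u] != 0 by apply: we'; rewrite wu (lt_trans uv vw).
  have [x /andP[ux xv]] := mvt u v au uv; rewrite fuv subrr => /esym/eqP.
  have [ax Nx] : a < x /\ N.[x] != 0.
    by apply: we'; rewrite (lt_trans wu ux) (lt_trans xv vw).
  have [Qx _] := PQ x ax.
  by rewrite !mulf_eq0 invr_eq0 sqrf_eq0 (negPf Nx) (negPf Qx) subr_eq0 gt_eqF.
exists (w - e), (w + e); split.
- move=> x /=; rewrite !in_itv /= andbT; exact: (fun h => (we' x h).1).
- by rewrite ltrBlDr ltrDl e_gt0.
move=> u v /andP[wu uw] /andP[wv vw] fuv.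
by have [/noteq|/noteq|//] := ltgtP u v; case; rewrite ?fuv.
Unshelve. all: by end_near.
Qed.

(** Passes from one real coordinate of the vector-valued map to the map itself. *)
Lemma locally_injective_at_comp (T U : Type) (f : R -> T) (h : T -> U) w :
  locally_injective_at a (h \o f) w -> locally_injective_at a f w.
Proof.
move=> [u [v [uv wuv inj]]]; exists u, v; split=> // x y ux uy fxy.
by apply: inj => //=; rewrite fxy.
Qed.

End RationalOnRay.

(** Finite sets of reals are closed, so the complement of [Z] without [z] is a neighbourhood of
    [z]. *)
Lemma finite_set_discrete (R : realType) (Z : set R) :
  finite_set Z -> discrete_subset Z.
Proof.
move=> finZ z Zz; have : nbhs z (~` (Z `\ z)).
  apply: open_nbhs_nbhs; split; last by case=> _ /(_ erefl).
  apply: closed_openC; apply: (accessible_finite_set_closed.1 _ (Z `\ z)).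
    exact/hausdorff_accessible/Rhausdorff.
  exact: finite_setD.
move=> /nbhs_ballP[e /= e_gt0 ze]; exists (z - e), (z + e).
split=> [|y Zy zey]; first by rewrite ltrBlDr ltrDl e_gt0.
by apply: contrapT => yz; apply: (ze y) => //; rewrite /ball /= ltr_distlC.
Qed.

(** * Scalars and matrices depending rationally on a real parameter *)

Section RationalMatrices.
Variables (R : realType) (k : scalars) (a : R).
Local Notation F := (scalar_field R k).

(** Splitting into real and imaginary parts lets the real mean value argument serve complex scalars
    too. *)
Definition rational_scalar (f : R -> F) :=
  rational_on_ray a (fun w => re_part (f w)) /\
  rational_on_ray a (fun w => im_part (f w)).

Lemma rational_scalar_eq f g : (forall w, a < w -> f w = g w) ->
  rational_scalar f -> rational_scalar g.
Proof.
by move=> fg [rf imf]; split; [move: rf|move: imf];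
  apply: rational_on_ray_eq => w aw; rewrite fg.
Qed.

Lemma rational_scalar_cst c : rational_scalar (fun=> c).
Proof. by split; exact: rational_on_ray_cst. Qed.

Lemma rational_scalar_of_real f :
  rational_on_ray a f -> rational_scalar (fun w => of_real k (f w)).
Proof.
move=> rf; split.
  by apply: rational_on_ray_eq rf => w _; rewrite of_realK.
by apply: rational_on_ray_eq (rational_on_ray_cst a 0) => w _; rewrite im_of_real.
Qed.

Lemma rational_scalarD f g : rational_scalar f -> rational_scalar g ->
  rational_scalar (fun w => f w + g w).
Proof.
move=> [rf imf] [rg img]; split.
  by apply: rational_on_ray_eq (rational_on_rayD rf rg) => w _; rewrite re_partD.
by apply: rational_on_ray_eq (rational_on_rayD imf img) => w _; rewrite im_partD.
Qed.

Lemma rational_scalarM f g : rational_scalar f -> rational_scalar g ->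
  rational_scalar (fun w => f w * g w).
Proof.
move=> [rf imf] [rg img]; split.
  apply: rational_on_ray_eq (rational_on_rayD (rational_on_rayM rf rg)
    (rational_on_rayN (rational_on_rayM imf img))) => w _.
  by rewrite re_partM.
apply: rational_on_ray_eq (rational_on_rayD (rational_on_rayM rf img)
  (rational_on_rayM imf rg)) => w _.
by rewrite im_partM.
Qed.

Lemma rational_scalarV f : (forall w, a < w -> f w != 0) -> rational_scalar f ->
  rational_scalar (fun w => (f w)^-1).
Proof.
move=> f0 [rf imf].
(* The squared modulus is the common denominator of both parts of the inverse. *)
have n_neq0 w : a < w -> re_part (f w) * re_part (f w) +
    im_part (f w) * im_part (f w) != 0.
  move=> aw; apply: contra (f0 w aw); rewrite -!expr2 => /eqP.
  by move=> /re_im_sqr_eq0 ->.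
have rV := rational_on_rayV n_neq0
  (rational_on_rayD (rational_on_rayM rf rf) (rational_on_rayM imf imf)).
split.
  by apply: rational_on_ray_eq (rational_on_rayM rf rV) => w _; rewrite re_partV.
apply: rational_on_ray_eq (rational_on_rayM (rational_on_rayN imf) rV) => w _.
by rewrite im_partV.
Qed.

Lemma rational_scalar_sum I (r : seq I) (f : I -> R -> F) :
  (forall i, rational_scalar (f i)) -> rational_scalar (fun w => \sum_(i <- r) f i w).
Proof.
move=> rf; elim: r => [|i r IHr].
  by apply: rational_scalar_eq (rational_scalar_cst 0) => w _; rewrite big_nil.
by apply: rational_scalar_eq (rational_scalarD (rf i) IHr) => w _; rewrite big_cons.
Qed.

Lemma rational_scalar_prod I (r : seq I) (f : I -> R -> F) :
  (forall i, rational_scalar (f i)) -> rational_scalar (fun w => \prod_(i <- r) f i w).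
Proof.
move=> rf; elim: r => [|i r IHr].
  by apply: rational_scalar_eq (rational_scalar_cst 1) => w _; rewrite big_nil.
by apply: rational_scalar_eq (rational_scalarM (rf i) IHr) => w _; rewrite big_cons.
Qed.

Definition rational_mx m n (f : R -> 'M[F]_(m, n)) :=
  forall i j, rational_scalar (fun w => f w i j).

Lemma rational_mx_eq m n (f g : R -> 'M[F]_(m, n)) :
  (forall w, a < w -> f w = g w) -> rational_mx f -> rational_mx g.
Proof.
by move=> fg rf i j; apply: rational_scalar_eq (rf i j) => w aw; rewrite fg.
Qed.

Lemma rational_mx_cst m n (A : 'M[F]_(m, n)) : rational_mx (fun=> A).
Proof. by move=> i j; exact: rational_scalar_cst. Qed.

Lemma rational_mxD m n (f g : R -> 'M[F]_(m, n)) :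
  rational_mx f -> rational_mx g -> rational_mx (fun w => f w + g w).
Proof.
move=> rf rg i j; apply: rational_scalar_eq (rational_scalarD (rf i j) (rg i j)).
by move=> w _; rewrite mxE.
Qed.

Lemma rational_mxM m n p (f : R -> 'M[F]_(m, n)) (g : R -> 'M[F]_(n, p)) :
  rational_mx f -> rational_mx g -> rational_mx (fun w => f w *m g w).
Proof.
move=> rf rg i j; pose h l w := f w i l * g w l j.
apply: rational_scalar_eq (@rational_scalar_sum _ (index_enum _) h _) => [w _|l].
  by rewrite mxE.
exact: rational_scalarM.
Qed.

Lemma rational_mx_scalar n (f : R -> R) : rational_on_ray a f ->
  rational_mx (fun w => (of_real k (f w))%:M : 'M[F]_n).
Proof.
move=> rf i j; apply: rational_scalar_eq (rational_scalarM
  (rational_scalar_of_real rf) (rational_scalar_cst (i == j)%:R)) => w _.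
by rewrite mxE mulr_natr.
Qed.

Lemma rational_det n (f : R -> 'M[F]_n) :
  rational_mx f -> rational_scalar (fun w => \det (f w)).
Proof.
(* Leibniz expansion, a sum over the permutations [s]. *)
move=> rf; apply: rational_scalar_sum => s.
apply: rational_scalarM; first exact: rational_scalar_cst.
exact: rational_scalar_prod.
Qed.

(** The inverse is the adjugate divided by the determinant, and cofactors are signed determinants of
    minors. *)
Lemma rational_mxV n (f : R -> 'M[F]_n) : (forall w, a < w -> f w \in unitmx) ->
  rational_mx f -> rational_mx (fun w => invmx (f w)).
Proof.
move=> fU rf i j.
have rc : rational_scalar (fun w => cofactor (f w) j i).
  apply: rational_scalarM; first exact: rational_scalar_cst.
  by apply: rational_det => s t; apply: rational_scalar_eq (rf _ _) => w _; rewrite !mxE.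
have rd : rational_scalar (fun w => (\det (f w))^-1).
  apply: rational_scalarV (rational_det rf) => w aw.
  by rewrite -unitfE -unitmxE fU.
apply: rational_scalar_eq (rational_scalarM rd rc) => w aw.
by rewrite /invmx fU // !mxE.
Qed.

End RationalMatrices.

(** * Rationality of the minimizer and finiteness of the exceptional set *)

Lemma D_A_rational (R : realType) (k : scalars) (n : nat)
    (A : 'M[scalar_field R k]_n) (S : {vspace 'cV[scalar_field R k]_n})
    (b : 'cV[scalar_field R k]_n) :
    is_hermitian A -> A \in unitmx -> (0 < n)%N ->
  rational_mx (omega_min A) (D_A A S b).
Proof.
move=> hA A_unit n_gt0; have [V [Vinj SE]] := vspace_basis_mx S.
apply: rational_mx_eq (fun w ww =>
  esym (D_A_formula hA A_unit n_gt0 Vinj ww b SE)) _.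
have rW : rational_mx (omega_min A) (fun w => invmx (A + (of_real k w)%:M)).
  apply: rational_mxV => [w ww|]; first exact: shift_unitmx.
  apply: rational_mxD; first exact: rational_mx_cst.
  apply: rational_mx_scalar.
  by apply: rational_on_ray_eq (rational_on_ray_poly _ 'X) => w _; rewrite hornerX.
have cst := rational_mx_cst (omega_min A).
apply: rational_mxM; last by do 2![apply: rational_mxM => //].
apply: rational_mxM => //; apply: rational_mxV => [w ww|].
  exact: normal_gram_unit.
by do 3![apply: rational_mxM => //].
Qed.

Theorem lemma5p4 (R : realType) (k : scalars) (n p : nat)
  (A : 'M[scalar_field R k]_n) (S : {vspace 'cV[scalar_field R k]_n})
  (b : 'cV[scalar_field R k]_n)
  (A_herm : is_hermitian A) (A_inv : A \in unitmx)
  (p_range : (1 <= p <= n)%N) (dimS : \dim S = p)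
  (nonconst : ~ constant_on_ray (omega_min A) (D_A A S b)) :
  let Z : set R := [set w : R | omega_min A < w /\
    ~ locally_injective_at (omega_min A) (D_A A S b) w] in
  [/\ lebesgue_measure Z = 0%E, discrete_subset Z & countable Z].
Proof.
move=> Z; have n_gt0 : (0 < n)%N by case/andP: p_range => /leq_trans; apply.
have ratD := D_A_rational S b A_herm A_inv n_gt0.
(* Finiteness gives all three conclusions. *)
suff finZ : finite_set Z.
  split; [exact/countable_lebesgue_measure0/finite_set_countable
         |exact: finite_set_discrete|exact: finite_set_countable].
(* It suffices to find one real function [h] of the minimizer that is locally injective off the
   roots of a nonzero [N]; [Z] then lies among these roots. *)
suff [h [N N0 hN]] : exists h : 'cV[scalar_field R k]_n -> R,
    exists2 N : {poly R}, N != 0 & forall w, omega_min A < w -> ~~ root N w ->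
      locally_injective_at (omega_min A) (h \o D_A A S b) w.
  apply: (@sub_finite_set _ _ [set` rootsR N]); last exact: finite_seq.
  move=> w [ww notinj] /=; rewrite -roots_on_rootsR // in_itv /=.
  apply: contrapT => /negP Nw; apply: notinj.
  exact/locally_injective_at_comp/hN.
apply: contrapT => noh; apply: nonconst.
(* Without such an [h], the dichotomy makes every rational real coordinate constant, hence all real
   and imaginary parts of the entries, and so the whole map. *)
have const (h : 'cV[scalar_field R k]_n -> R) :
    rational_on_ray (omega_min A) (h \o D_A A S b) ->
    constant_on_ray (omega_min A) (h \o D_A A S b).
  by move=> /rational_on_ray_constant_or_locally_injective[//|?]; case: noh; exists h.
exists (D_A A S b (omega_min A + 1)) => w ww.
have w1 : omega_min A < omega_min A + 1 by rewrite ltrDl.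
apply/matrixP => i j; have [rD imD] := ratD i j.
have [c cE] := const (fun x => re_part (x i j)) rD.
have [c' cE'] := const (fun x => im_part (x i j)) imD.
by apply: eq_scalar; [rewrite [LHS]cE // [RHS]cE|rewrite [LHS]cE' // [RHS]cE'].
Qed.
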